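(* Let $V$ be a complex vector space and let $J : V \otimes V \to V \otimes V$ be a linear map such that $J \circ J = - I_2$ and $J^{12} \circ J^{23} = J^{23} \circ J^{12}$. For $x \in \mathbb{C}$ put $R(x) = \cos x \, I_2 + \sin x \, J$. Then $R$ satisfies the colored Yang-Baxter equation: for all $x, y \in \mathbb{C}$, $$R^{12}(x) \circ R^{23}(x+y) \circ R^{12}(y) = R^{23}(y) \circ R^{12}(x+y) \circ R^{23}(x)$$ as linear maps $V^{\otimes 3} \to V^{\otimes 3}$.
   Context: Tensor products are over $\mathbb{C}$. $I_1 : V \to V$ and $I_2 : V \otimes V \to V \otimes V$ denote the identity maps. For a linear map $T : V\otimes V \to V \otimes V$, the maps $T^{12}, T^{23} : V^{\otimes 3} \to V^{\otimes 3}$ are $T^{12} = T \otimes I_1$ and $T^{23} = I_1 \otimes T$; $R^{12}(x)$ and $R^{23}(x)$ mean $(R(x))^{12}$ and $(R(x))^{23}$. *)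

(* Defs.v *)
From HB Require Import structures.
From mathcomp Require Import all_boot all_order all_algebra.
From mathcomp Require Import generic_quotient ring_quotient.
From mathcomp Require Import finmap monalg.
From mathcomp Require Import all_classical all_reals all_analysis.
From mathcomp Require Import complex.

Set Implicit Arguments.
Unset Strict Implicit.
Unset Printing Implicit Defensive.

Import GRing.Theory Num.Theory numFieldNormedType.Exports.

Local Open Scope ring_scope.

Section TensorProduct.
Variables (K : comNzRingType) (V W : lmodType K).

Definition free_gen (v : V) (w : W) : {malg K[(V * W)%type]} :=
  mkmalgU (v, w) 1.

(* The submodule of the free module on V * W spanned by the relations that
   make (v, w) |-> free_gen v w bilinear. *)
Inductive tensor_rel : {malg K[(V * W)%type]} -> Prop :=
| tensor_rel0 : tensor_rel 0
| tensor_relP a x y : tensor_rel x -> tensor_rel y -> tensor_rel (a *: x + y)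
| tensor_relDl v v' w :
    tensor_rel (free_gen (v + v') w - (free_gen v w + free_gen v' w))
| tensor_relDr v w w' :
    tensor_rel (free_gen v (w + w') - (free_gen v w + free_gen v w'))
| tensor_relZl a v w : tensor_rel (free_gen (a *: v) w - a *: free_gen v w)
| tensor_relZr a v w : tensor_rel (free_gen v (a *: w) - a *: free_gen v w).

Definition tensor_relb : {pred {malg K[(V * W)%type]}} :=
  fun x => `[< tensor_rel x >].

Lemma tensor_relZ a x : tensor_rel x -> tensor_rel (a *: x).
Proof. by move=> xr; rewrite -[a *: x]addr0; exact: tensor_relP tensor_rel0. Qed.

Lemma tensor_relb_zmod_closed : zmod_closed tensor_relb.
Proof.
split; first exact/asboolP/tensor_rel0.
move=> x y /asboolP xr /asboolP yr; apply/asboolP.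
by rewrite addrC -scaleN1r; exact: tensor_relP.
Qed.

HB.instance Definition _ :=
  GRing.isZmodClosed.Build {malg K[(V * W)%type]} tensor_relb
    tensor_relb_zmod_closed.

Definition tensor : Type := Quotient.quot tensor_relb.

HB.instance Definition _ := GRing.Zmodule.on tensor.
HB.instance Definition _ := Choice.on tensor.

Definition tensor_pi (x : {malg K[(V * W)%type]}) : tensor :=
  \pi_(Quotient.quot tensor_relb)%qT x.
Definition tensor_repr (t : tensor) : {malg K[(V * W)%type]} :=
  repr (t : Quotient.quot tensor_relb).

Lemma tensor_reprK : cancel tensor_repr tensor_pi.
Proof. by move=> t; exact: reprK. Qed.

Lemma tensor_piP x y : tensor_pi x = tensor_pi y <-> tensor_rel (x - y).
Proof.
have E := @Quotient.idealrBE _ tensor_relb x y.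
split; first by move=> /eqP; rewrite -E => /asboolP.
by move=> h; apply/eqP; rewrite -E; exact/asboolP.
Qed.

Lemma tensor_piD x y : tensor_pi (x + y) = tensor_pi x + tensor_pi y.
Proof. by rewrite /tensor_pi raddfD. Qed.

(* Locked: otherwise failed unifications unfold the quotient. *)
Fact tensor_key : unit. Proof. exact: tt. Qed.

Definition tensor_scale : K -> tensor -> tensor :=
  locked_with tensor_key (fun a t => tensor_pi (a *: tensor_repr t)).
Canonical tensor_scale_unlockable := [unlockable fun tensor_scale].

Lemma tensor_scale_pi a x : tensor_scale a (tensor_pi x) = tensor_pi (a *: x).
Proof.
rewrite unlock; apply/tensor_piP; rewrite -scalerBr; apply: tensor_relZ.
by apply/tensor_piP; rewrite tensor_reprK.
Qed.

Lemma tensor_scaleA a b t :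
  tensor_scale a (tensor_scale b t) = tensor_scale (a * b) t.
Proof. by rewrite -[t]tensor_reprK !tensor_scale_pi scalerA. Qed.

Lemma tensor_scale1 : left_id 1 tensor_scale.
Proof. by move=> t; rewrite [tensor_scale]unlock scale1r tensor_reprK. Qed.

Lemma tensor_scaleDr : right_distributive tensor_scale +%R.
Proof.
move=> a t u; rewrite -[t]tensor_reprK -[u]tensor_reprK -tensor_piD.
by rewrite !tensor_scale_pi scalerDr tensor_piD.
Qed.

Lemma tensor_scaleDl t : {morph tensor_scale^~ t : a b / a + b}.
Proof. by move=> a b; rewrite [tensor_scale]unlock scalerDl tensor_piD. Qed.

HB.instance Definition _ := GRing.Zmodule_isLmodule.Build K tensor
  tensor_scaleA tensor_scale1 tensor_scaleDr tensor_scaleDl.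

Lemma tensor_piZ a x : tensor_pi (a *: x) = a *: tensor_pi x.
Proof. by rewrite -tensor_scale_pi. Qed.

Definition tensor_lmod : lmodType K := tensor.

Definition tens : V -> W -> tensor_lmod :=
  locked_with tensor_key (fun v w => tensor_pi (free_gen v w)).

Lemma tensE v w : tens v w = tensor_pi (free_gen v w).
Proof. by rewrite /tens unlock. Qed.

End TensorProduct.

Notation "V ⊗ W" := (tensor_lmod V W) (at level 40, left associativity).
Notation "v ⊗ₜ w" := (tens v w) (at level 40, left associativity).

Section Tens.
Variables (K : comNzRingType) (V W : lmodType K).

Lemma tensDl (v v' : V) (w : W) : (v + v') ⊗ₜ w = v ⊗ₜ w + v' ⊗ₜ w.
Proof. by rewrite !tensE -tensor_piD; apply/tensor_piP/tensor_relDl. Qed.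

Lemma tensDr (v : V) (w w' : W) : v ⊗ₜ (w + w') = v ⊗ₜ w + v ⊗ₜ w'.
Proof. by rewrite !tensE -tensor_piD; apply/tensor_piP/tensor_relDr. Qed.

Lemma tensZl a (v : V) (w : W) : (a *: v) ⊗ₜ w = a *: (v ⊗ₜ w).
Proof. by rewrite !tensE -tensor_piZ; apply/tensor_piP/tensor_relZl. Qed.

Lemma tensZr a (v : V) (w : W) : v ⊗ₜ (a *: w) = a *: (v ⊗ₜ w).
Proof. by rewrite !tensE -tensor_piZ; apply/tensor_piP/tensor_relZr. Qed.

Lemma tens0l (w : W) : (0 : V) ⊗ₜ w = 0.
Proof. by have := tensZl 0 0 w; rewrite !scale0r. Qed.

Lemma tens0r (v : V) : v ⊗ₜ (0 : W) = 0.
Proof. by have := tensZr 0 v 0; rewrite !scale0r. Qed.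

Lemma malg_sum_gen (x : {malg K[(V * W)%type]}) :
  x = \sum_(k <- msupp x) x@_k *: free_gen k.1 k.2.
Proof.
rewrite [LHS]monalgE; apply: eq_bigr => -[v w] _; apply/malgP => k.
by rewrite mcoeffZ !mcoeffU mulr_natr.
Qed.

Lemma tensor_ind (P : V ⊗ W -> Prop) :
  P 0 -> (forall a t u, P t -> P u -> P (a *: t + u)) ->
  (forall v w, P (v ⊗ₜ w)) -> forall t, P t.
Proof.
move=> P0 PP Pt t; rewrite -[t]tensor_reprK [tensor_repr t]malg_sum_gen.
elim: {1}(msupp (tensor_repr t) : seq _) => [|k s IHs].
  rewrite big_nil; have -> // : tensor_pi 0 = 0 :> V ⊗ W.
  by rewrite -(scale0r 0) tensor_piZ scale0r.
by rewrite big_cons tensor_piD tensor_piZ; apply: PP => //; have := Pt k.1 k.2; rewrite tensE.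
Qed.

End Tens.

Section TensorLift.
Variables (K : comNzRingType) (V W U : lmodType K).
Implicit Type f : V -> W -> U.

Definition free_lift f (x : {malg K[(V * W)%type]}) : U :=
  \sum_(k <- msupp x) x@_k *: f k.1 k.2.

(* The map V ⊗ W -> U induced by f, for bilinear f. *)
Definition tensor_lift : (V -> W -> U) -> V ⊗ W -> U :=
  locked_with tensor_key (fun f t => free_lift f (tensor_repr t)).
Canonical tensor_lift_unlockable := [unlockable fun tensor_lift].

Lemma free_liftEw f (d : {fset V * W}) x : (msupp x `<=` d)%fset ->
  free_lift f x = \sum_(k <- d) x@_k *: f k.1 k.2.
Proof.
move=> sxd; rewrite /free_lift; apply: big_fset_incl => // k _ kx.
by rewrite mcoeff_outdom // scale0r.
Qed.

Lemma free_lift_is_linear f : linear (free_lift f).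
Proof.
move=> a x y; pose d := (msupp (a *: x + y) `|` (msupp x `|` msupp y))%fset.
rewrite !(@free_liftEw f d) ?fsubsetUl //; last 2 first.
- by rewrite /d fsetUA fsubsetUr.
- by rewrite /d fsetUCA fsubsetUl.
rewrite scaler_sumr -big_split; apply: eq_bigr => k _.
by rewrite mcoeffD mcoeffZ scalerDl scalerA.
Qed.

HB.instance Definition _ f :=
  GRing.isLinear.Build K {malg K[(V * W)%type]} U _ (free_lift f)
    (free_lift_is_linear f).

Lemma free_lift_gen f v w : free_lift f (free_gen v w) = f v w.
Proof.
rewrite (@free_liftEw f [fset (v, w)]%fset) ?msuppU_le // big_seq_fset1.
by rewrite mcoeffUU scale1r.
Qed.

Lemma free_lift_rel (f : {bilinear V -> W -> U}) x :
  tensor_rel x -> free_lift f x = 0.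
Proof.
elim=> {x}.
- exact: linear0.
- by move=> a x y _ x0 _ y0; rewrite linearP /= x0 y0 scaler0 addr0.
- by move=> v v' w; rewrite linearB linearD /= !free_lift_gen linearDl subrr.
- by move=> v w w'; rewrite linearB linearD /= !free_lift_gen linearD subrr.
- by move=> a v w; rewrite linearB linearZ /= !free_lift_gen linearZl subrr.
- by move=> a v w; rewrite linearB linearZ /= !free_lift_gen linearZ subrr.
Qed.

Lemma tensor_lift_pi (f : {bilinear V -> W -> U}) x :
  tensor_lift f (tensor_pi x) = free_lift f x.
Proof.
rewrite unlock; apply/eqP; rewrite -subr_eq0 -linearB; apply/eqP/free_lift_rel/tensor_piP.
exact: tensor_reprK.
Qed.

Lemma tensor_lift_is_linear (f : {bilinear V -> W -> U}) :
  linear (tensor_lift f).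
Proof.
move=> a t u; rewrite -[t]tensor_reprK -[u]tensor_reprK -tensor_piZ -tensor_piD.
by rewrite !tensor_lift_pi linearP.
Qed.

HB.instance Definition _ (f : {bilinear V -> W -> U}) :=
  GRing.isLinear.Build K (V ⊗ W) U _ (tensor_lift f) (tensor_lift_is_linear f).

Lemma tensor_liftE (f : {bilinear V -> W -> U}) v w :
  tensor_lift f (v ⊗ₜ w) = f v w.
Proof. by rewrite tensE tensor_lift_pi free_lift_gen. Qed.

Lemma tensor_lift_add f a g t :
  tensor_lift (fun v w => a *: f v w + g v w) t =
  a *: tensor_lift f t + tensor_lift g t.
Proof.
rewrite unlock /free_lift scaler_sumr -big_split; apply: eq_bigr => k _.
by rewrite scalerDr !scalerA mulrC.
Qed.

Lemma tensor_ext (g h : {linear V ⊗ W -> U}) :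
  (forall v w, g (v ⊗ₜ w) = h (v ⊗ₜ w)) -> g =1 h.
Proof.
move=> gh; elim/tensor_ind => [|a t u ght ghu|//]; first by rewrite !linear0.
by rewrite !linearP ght ghu.
Qed.

End TensorLift.

Section TensorExt3.
Variables (K : comNzRingType) (V1 V2 V3 U : lmodType K).

Lemma tensor_ext3l (g h : {linear (V1 ⊗ V2) ⊗ V3 -> U}) :
  (forall u v w, g ((u ⊗ₜ v) ⊗ₜ w) = h ((u ⊗ₜ v) ⊗ₜ w)) -> g =1 h.
Proof.
move=> gh; apply: tensor_ext => t w; elim/tensor_ind: t => [|a t s IHt IHs|//].
  by rewrite tens0l !linear0.
by rewrite tensDl tensZl [LHS]linearP [RHS]linearP IHt IHs.
Qed.

Lemma tensor_ext3r (g h : {linear V1 ⊗ (V2 ⊗ V3) -> U}) :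
  (forall u v w, g (u ⊗ₜ (v ⊗ₜ w)) = h (u ⊗ₜ (v ⊗ₜ w))) -> g =1 h.
Proof.
move=> gh; apply: tensor_ext => u t; elim/tensor_ind: t => [|a t s IHt IHs|//].
  by rewrite tens0r !linear0.
by rewrite tensDr tensZr [LHS]linearP [RHS]linearP IHt IHs.
Qed.

End TensorExt3.

Section TensorMap.
Variables (K : comNzRingType) (V V' W W' : lmodType K).
Variables (f : {linear V -> V'}) (g : {linear W -> W'}).

Definition tens2 (v : V) (w : W) : V' ⊗ W' := f v ⊗ₜ g w.

Lemma tens2_bilinear : bilinear_for *:%R *:%R tens2.
Proof.
split=> u a x y.
  by rewrite /tens2 /= linearP tensDl tensZl.
by rewrite /tens2 /= linearP tensDr tensZr.
Qed.

HB.instance Definition _ :=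
  bilinear_isBilinear.Build K V W (V' ⊗ W') _ _ tens2 tens2_bilinear.

Definition tensor_map : V ⊗ W -> V' ⊗ W' := tensor_lift tens2.

HB.instance Definition _ := GRing.Linear.on tensor_map.

Lemma tensor_mapE v w : tensor_map (v ⊗ₜ w) = f v ⊗ₜ g w.
Proof. exact: tensor_liftE. Qed.

End TensorMap.

Section TensorAssoc.
Variables (K : comNzRingType) (U V W : lmodType K).

Definition assocl1 (w : W) (u : U) (v : V) : U ⊗ (V ⊗ W) := u ⊗ₜ (v ⊗ₜ w).

Lemma assocl1_bilinear w : bilinear_for *:%R *:%R (assocl1 w).
Proof.
split=> z a x y; rewrite /assocl1 /=; first by rewrite tensDl tensZl.
by rewrite tensDl tensZl tensDr tensZr.
Qed.

HB.instance Definition _ w :=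
  bilinear_isBilinear.Build K U V (U ⊗ (V ⊗ W)) _ _ (assocl1 w)
    (assocl1_bilinear w).

Definition assocl2 (t : U ⊗ V) (w : W) : U ⊗ (V ⊗ W) :=
  tensor_lift (assocl1 w) t.

Lemma assocl2_bilinear : bilinear_for *:%R *:%R assocl2.
Proof.
split=> z a x y; rewrite /assocl2 /=; first by rewrite linearP.
rewrite (_ : assocl1 _ = fun u v => a *: assocl1 x u v + assocl1 y u v).
  exact: (tensor_lift_add (assocl1 x) a (assocl1 y) z).
apply/funext => u; apply/funext => v.
by rewrite /assocl1 tensDr tensZr tensDr tensZr.
Qed.

HB.instance Definition _ :=
  bilinear_isBilinear.Build K (U ⊗ V) W (U ⊗ (V ⊗ W)) _ _ assocl2
    assocl2_bilinear.

Definition tensor_assoc : (U ⊗ V) ⊗ W -> U ⊗ (V ⊗ W) := tensor_lift assocl2.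

HB.instance Definition _ := GRing.Linear.on tensor_assoc.

Lemma tensor_assocE u v w : tensor_assoc ((u ⊗ₜ v) ⊗ₜ w) = u ⊗ₜ (v ⊗ₜ w).
Proof. by rewrite /tensor_assoc tensor_liftE /= /assocl2 tensor_liftE. Qed.

Definition assocr1 (u : U) (v : V) (w : W) : (U ⊗ V) ⊗ W := (u ⊗ₜ v) ⊗ₜ w.

Lemma assocr1_bilinear u : bilinear_for *:%R *:%R (assocr1 u).
Proof.
split=> z a x y; rewrite /assocr1 /=; last by rewrite tensDr tensZr.
by rewrite tensDr tensZr tensDl tensZl.
Qed.

HB.instance Definition _ u :=
  bilinear_isBilinear.Build K V W ((U ⊗ V) ⊗ W) _ _ (assocr1 u)
    (assocr1_bilinear u).

Definition assocr2 (u : U) (t : V ⊗ W) : (U ⊗ V) ⊗ W :=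
  tensor_lift (assocr1 u) t.

Lemma assocr2_bilinear : bilinear_for *:%R *:%R assocr2.
Proof.
split=> z a x y; rewrite /assocr2 /=; last by rewrite linearP.
rewrite (_ : assocr1 _ = fun v w => a *: assocr1 x v w + assocr1 y v w).
  exact: (tensor_lift_add (assocr1 x) a (assocr1 y) z).
apply/funext => v; apply/funext => w.
by rewrite /assocr1 tensDl tensZl tensDl tensZl.
Qed.

HB.instance Definition _ :=
  bilinear_isBilinear.Build K U (V ⊗ W) ((U ⊗ V) ⊗ W) _ _ assocr2
    assocr2_bilinear.

Definition tensor_assoc_inv : U ⊗ (V ⊗ W) -> (U ⊗ V) ⊗ W := tensor_lift assocr2.

HB.instance Definition _ := GRing.Linear.on tensor_assoc_inv.

Lemma tensor_assoc_invE u v w :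
  tensor_assoc_inv (u ⊗ₜ (v ⊗ₜ w)) = (u ⊗ₜ v) ⊗ₜ w.
Proof. by rewrite /tensor_assoc_inv tensor_liftE /= /assocr2 tensor_liftE. Qed.

Lemma tensor_assocK : cancel tensor_assoc tensor_assoc_inv.
Proof.
pose g : {linear (U ⊗ V) ⊗ W -> (U ⊗ V) ⊗ W} := tensor_assoc_inv \o tensor_assoc.
apply: (@tensor_ext3l _ _ _ _ _ g idfun) => u v w.
by rewrite /g /= tensor_assocE tensor_assoc_invE.
Qed.

Lemma tensor_assoc_invK : cancel tensor_assoc_inv tensor_assoc.
Proof.
pose g : {linear U ⊗ (V ⊗ W) -> U ⊗ (V ⊗ W)} := tensor_assoc \o tensor_assoc_inv.
apply: (@tensor_ext3r _ _ _ _ _ g idfun) => u v w.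
by rewrite /g /= tensor_assoc_invE tensor_assocE.
Qed.

End TensorAssoc.

Section LegNotation.
Variables (K : comNzRingType) (V : lmodType K).

(* V^{⊗3} is represented as (V ⊗ V) ⊗ V. *)
Definition op12 (T : {linear V ⊗ V -> V ⊗ V}) :
    (V ⊗ V) ⊗ V -> (V ⊗ V) ⊗ V :=
  tensor_map T (idfun : {linear V -> V}).

HB.instance Definition _ T := GRing.Linear.on (op12 T).

Definition op23 (T : {linear V ⊗ V -> V ⊗ V}) :
    (V ⊗ V) ⊗ V -> (V ⊗ V) ⊗ V :=
  @tensor_assoc_inv K V V V \o tensor_map (idfun : {linear V -> V}) T
    \o @tensor_assoc K V V V.

HB.instance Definition _ T := GRing.Linear.on (op23 T).

Lemma op12E T t w : op12 T (t ⊗ₜ w) = T t ⊗ₜ w.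
Proof. exact: tensor_mapE. Qed.

Lemma op23E T u v w :
  op23 T ((u ⊗ₜ v) ⊗ₜ w) = tensor_assoc_inv (u ⊗ₜ T (v ⊗ₜ w)).
Proof. by rewrite /op23 /= tensor_assocE tensor_mapE. Qed.

End LegNotation.

(* The power series of cos and sin, for the topology given by the norm of C;
   analysis.trigo only has them on a realType. *)
Section ComplexTrigo.
Local Open Scope classical_set_scope.
Variable C : numFieldType.

Definition ccos (z : C) : C :=
  lim (series (fun n => (-1) ^+ n * z ^+ n.*2 / (n.*2)`!%:R : C) @ \oo).

Definition csin (z : C) : C :=
  lim (series (fun n => (-1) ^+ n * z ^+ n.*2.+1 / (n.*2.+1)`!%:R : C) @ \oo).

End ComplexTrigo.

Section Rmatrix.
Variables (R : realType) (V : lmodType R[i]) (J : {linear V ⊗ V -> V ⊗ V}).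

Definition Rmat (x : R[i]) : V ⊗ V -> V ⊗ V :=
  (ccos x \*: (idfun : {linear V ⊗ V -> V ⊗ V})) \+ (csin x \*: J).

HB.instance Definition _ x := GRing.Linear.on (Rmat x).

End Rmatrix.

(* Main.v *)
Require Import Defs.
From HB Require Import structures.
From mathcomp Require Import all_boot all_order all_algebra.
From mathcomp Require Import all_classical all_reals all_analysis.
From mathcomp Require Import complex ring.
Import GRing.Theory Num.Theory.
Local Open Scope ring_scope.

(** Since [J12] and [J23] commute and square to [-1], each [R12(z)] is a
"rotation" [cos z + sin z J12], rotations along the same leg add their angles,
and rotations along different legs commute; both sides of the equation are then
[R12(x + y) R23(x + y)].

Adding angles needs the addition formulas of the complex sine and cosine series,
which follow from [e^(z + w) = e^z e^w]. There the defect
[E_n(z) E_n(w) - E_n(z + w)] of the partial sums of the exponential series is a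
sum of terms [z^i w^j / (i! j!)] with [i + j >= n], so its norm is at most the
same defect at [`|z|] and [`|w|], which vanishes in the limit by the real
formula. *)

(** * The complex exponential: convergence and addition formula *)

Section ExpSeries.
Import Order.TTheory numFieldNormedType.Exports.
Local Set Implicit Arguments.
Local Unset Strict Implicit.
Local Open Scope classical_set_scope.

(* The topology of a [numFieldType] is keyed on the abstract sort, so it is not
   found on [R[i]] itself. *)
Definition complex_numField (R : rcfType) : numFieldType := R[i].
Local Notation C := complex_numField.

Definition exp_sum (F : numFieldType) (z : F) (n : nat) : F :=
  \sum_(0 <= k < n) z ^+ k / k`!%:R.

(** Exchange the two sums and shift the inner one by [i], so that [j = k - i]. *)
Lemma triangular_sum (M : zmodType) (f : nat -> nat -> M) n :
  \sum_(0 <= k < n) \sum_(0 <= i < k.+1) f i (k - i)%N =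
  \sum_(0 <= i < n) \sum_(0 <= j < n | (i + j < n)%N) f i j.
Proof.
under eq_big_nat => k /andP[_ kn] do rewrite (big_nat_widen _ _ n) //.
rewrite (exchange_big_dep_nat xpredT) //=; apply: eq_big_nat => i /andP[_ lein].
transitivity (\sum_(0 + i <= k < n) f i (k - i)%N).
  by rewrite add0n [RHS](big_nat_widenl _ 0).
rewrite big_addn (big_nat_widen _ _ n) ?leq_subr //.
by apply: eq_big => [j|j _]; rewrite ?addnK // ltn_subRL.
Qed.

(** By the binomial theorem, [exp_sum (z + w) n] is the part [i + j < n] of the double sum for the
    product. *)
Lemma exp_sumM_sub (F : numFieldType) (z w : F) n :
  exp_sum z n * exp_sum w n - exp_sum (z + w) n =
  \sum_(0 <= i < n) \sum_(0 <= j < n | (n <= i + j)%N)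
    (z ^+ i / i`!%:R) * (w ^+ j / j`!%:R).
Proof.
have -> : exp_sum (z + w) n =
    \sum_(0 <= i < n) \sum_(0 <= j < n | (i + j < n)%N)
    (z ^+ i / i`!%:R) * (w ^+ j / j`!%:R).
  rewrite -triangular_sum; apply: eq_bigr => k _.
  rewrite addrC exprDn mulr_suml big_mkord.
  apply: eq_bigr => -[i /=] /[1!ltnS] ik _.
  have factn0 m : m`!%:R != 0 :> F by rewrite pnatr_eq0 -lt0n fact_gt0.
  (* Replacing [k!] by its factorization in [bin_fact] lets the binomial coefficient cancel. *)
  rewrite -mulr_natr; move: (bin_fact ik) => /(congr1 (fun m => m%:R : F)).
  rewrite !natrM => <-; field.
  by rewrite !factn0 pnatr_eq0 -lt0n bin_gt0 ik.
rewrite /exp_sum mulr_suml -sumrB; apply: eq_bigr => i _.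
rewrite mulr_sumr (bigID (fun j => (i + j < n)%N)) /= addrC addrK.
by apply: eq_bigl => j; rewrite -leqNgt.
Qed.

Lemma ler_norm_exp_sumM_sub (F : numFieldType) (z w : F) n :
  `|exp_sum z n * exp_sum w n - exp_sum (z + w) n| <=
  exp_sum `|z| n * exp_sum `|w| n - exp_sum (`|z| + `|w|) n.
Proof.
rewrite !exp_sumM_sub; apply: (le_trans (ler_norm_sum _ _ _)).
apply: ler_sum => i _.
apply: (le_trans (ler_norm_sum _ _ _)); apply: ler_sum => j _.
by rewrite !normrM !normfV !normrX !normr_nat.
Qed.

Lemma cvg_exp_sum (R : realType) (x : R) : exp_sum x @ \oo --> expR x.
Proof. exact: is_cvg_series_exp_coeff. Qed.

Lemma cvg_real_complex (R : realType) (u : nat -> R) (l : R) :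
  u @ \oo --> l -> (fun n => (u n)%:C%C : C R) @ \oo --> (l%:C%C : C R).
Proof.
move=> ul; apply/cvgrPdist_lt => e e0.
(* In the order of [R[i]], a positive [e] is real. *)
have ee : e = (complex.Re e)%:C%C.
  by move: e0; rewrite ltcE /= => /andP[/eqP e0 _]; case: e e0 => a b /= ->.
have re0 : 0 < complex.Re e by rewrite -ltcR -ee.
move/cvgrPdist_lt/(_ _ re0): ul; apply: filterS => n.
by rewrite -rmorphB /= normc_def /= expr0n addr0 sqrtr_sqr {2}ee ltcR.
Qed.

Lemma normc_Re (R : rcfType) (z : R[i]) : `|z| = (complex.Re `|z|)%:C%C.
Proof. by rewrite normc_def. Qed.

Lemma exp_sum_real_complex (R : realType) (x : R) n :
  exp_sum (x%:C%C : R[i]) n = (exp_sum x n)%:C%C.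
Proof.
rewrite rmorph_sum; apply: eq_bigr => k _.
by rewrite rmorphM fmorphV rmorphXn rmorph_nat.
Qed.

Lemma normc_ge_Im (R : rcfType) (z : R[i]) : `|complex.Im z|%:C%C <= `|z|.
Proof.
by rewrite normc_def lecR -sqrtr_sqr ler_wsqrtr // lerDr sqr_ge0.
Qed.

(** Joins real and imaginary parts, with [c] the imaginary unit; stated over an abstract [F], where
    the topology is found. *)
Lemma cvg_addM (F : numFieldType) (c : F) (u v : nat -> F) (a b : F) :
  u @ \oo --> a -> v @ \oo --> b ->
  (fun n => u n + c * v n) @ \oo --> a + c * b.
Proof. by move=> ua vb; apply: cvgD => //; apply: cvgM => //; exact: cvg_cst. Qed.

Lemma is_cvg_exp_sum (R : realType) (z : C R) : cvgn (exp_sum z).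
Proof.
pose t k : C R := z ^+ k / k`!%:R.
have tE k : `|t k| = (exp_coeff (complex.Re `|z|) k)%:C%C.
  rewrite /t /exp_coeff /= normrM normfV normrX normr_nat {1}normc_Re.
  by rewrite rmorphM fmorphV rmorphXn rmorph_nat.
(* Used with [p] the real and the imaginary part: both real series are dominated by the exponential
   series at [|z|]. *)
have abs_cvg (p : C R -> R) : (forall z, `|p z|%:C%C <= `|z|) ->
    cvgn (series (p \o t)).
  move=> ple; apply: normed_cvg.
  apply: series_le_cvg (is_cvg_series_exp_coeff (complex.Re `|z|)).
  - by move=> n; exact: normr_ge0.
  - move=> n; rewrite -lecR -tE; exact: normr_ge0.
  - by move=> n /=; rewrite -lecR -tE ple.
have /cvg_ex[a /cvg_real_complex acvg] := abs_cvg _ (@normc_ge_Re R).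
have /cvg_ex[b /cvg_real_complex bcvg] := abs_cvg _ (@normc_ge_Im R).
apply/cvg_ex; exists (a%:C + 'i * b%:C : C R)%C.
rewrite (_ : exp_sum z = (fun n => (series (@complex.Re R \o t) n)%:C +
    'i * (series (@complex.Im R \o t) n)%:C)%C).
  exact: (@cvg_addM (C R) _ _ _ _ _ acvg bcvg).
apply/funext => n; rewrite /exp_sum /series /= !rmorph_sum /= mulr_sumr.
rewrite -big_split /=.
by apply: eq_bigr => k _; exact: complexE.
Qed.

Definition cexp (R : realType) (z : C R) : C R := lim (exp_sum z @ \oo).

Lemma cvg_cexp (R : realType) (z : C R) : exp_sum z @ \oo --> cexp z.
Proof. exact: is_cvg_exp_sum. Qed.

Lemma norm_le_cvg0 (R : realType) (u : nat -> C R) (g : nat -> R) :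
  (forall n, `|u n| <= (g n)%:C%C) -> g @ \oo --> 0 -> u @ \oo --> (0 : C R).
Proof.
move=> ug /cvg_real_complex g0; apply/cvgr0Pnorm_le => e e0.
move/cvgr0Pnorm_le/(_ _ e0): g0; apply: filterS => n; apply: le_trans.
by rewrite (ger0_norm (le_trans (normr_ge0 _) (ug n))) ug.
Qed.

(** Uniqueness of limits: the difference tends to [a * b - c] as well as to 0. *)
Lemma cvg_mulB_eq (F : numFieldType) (u v w : nat -> F) (a b c : F) :
  u @ \oo --> a -> v @ \oo --> b -> w @ \oo --> c ->
  (fun n => u n * v n - w n) @ \oo --> 0 -> c = a * b.
Proof.
move=> ua vb wc uvw0; apply/esym/eqP; rewrite -subr_eq0; apply/eqP.
have uvw : (fun n => u n * v n - w n) @ \oo --> a * b - c.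
  exact: (cvgB (cvgM ua vb) wc).
rewrite -(cvg_lim (@norm_hausdorff _ _) uvw).
exact: (cvg_lim (@norm_hausdorff _ _) uvw0).
Qed.

Lemma cexpD (R : realType) (z w : C R) : cexp (z + w) = cexp z * cexp w.
Proof.
apply: (@cvg_mulB_eq (C R) _ _ _ _ _ _
  (@cvg_cexp R z) (@cvg_cexp R w) (@cvg_cexp R (z + w))).
pose r := complex.Re `|z|; pose s := complex.Re `|w|.
apply: (@norm_le_cvg0 _ _
  (fun n => exp_sum r n * exp_sum s n - exp_sum (r + s) n)).
  move=> n; apply: (le_trans (ler_norm_exp_sumM_sub _ _ _)).
  rewrite (@normc_Re _ z) (@normc_Re _ w) -/r -/s -rmorphD.
  rewrite !exp_sum_real_complex.
  by rewrite -rmorphM -rmorphB.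
(* The limit 0 is written as [expR r * expR s - expR (r + s)], to be reached termwise. *)
rewrite -(subrr (expR (r + s))) {1}expRD.
apply: cvgB; last exact: cvg_exp_sum.
by apply: cvgM; exact: cvg_exp_sum.
Qed.

(** Needed because [n] terms of the cosine or sine series correspond to [2n] terms of the
    exponential series. *)
Lemma cvg_double (T : topologicalType) (u : nat -> T) (l : T) :
  u @ \oo --> l -> (fun n => u n.*2) @ \oo --> l.
Proof.
move=> ul; apply: (@cvg_comp _ _ _ double u \oo \oo) ul.
move=> A [N _ NA]; exists N => // n /= Nn; apply: NA => /=.
by rewrite (leq_trans Nn) // -addnn leq_addr.
Qed.

(** * Euler's formulas, for a square root [i] of -1 *)

Section Euler.
Variables (F : numFieldType) (i : F).
Hypothesis i_sqr : i ^+ 2 = -1.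

Let exprM_i (z : F) n : (i * z) ^+ n.*2 = (-1) ^+ n * z ^+ n.*2.
Proof. by rewrite exprMn -!mul2n exprM i_sqr. Qed.

(** The odd powers cancel between [i * z] and [- (i * z)]. *)
Lemma cos_sumE (z : F) n :
  series (fun n => (-1) ^+ n * z ^+ n.*2 / (n.*2)`!%:R : F) n =
  2^-1 * (exp_sum (i * z) n.*2 + exp_sum (- (i * z)) n.*2).
Proof.
rewrite /series /exp_sum /=; elim: n => [|n IHn].
  by rewrite !big_geq // addr0 mulr0.
rewrite doubleS !big_nat_recr //= IHn !(exprS _ n.*2).
rewrite -!mul2n !(exprM (- _)) sqrrN.
rewrite -!(exprM (i * z)) !mul2n exprM_i; field.
by rewrite !pnatr_eq0 -!lt0n !fact_gt0.
Qed.

(** The even powers cancel; the factor [- (i / 2)] is [1 / (2 i)]. *)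
Lemma sin_sumE (z : F) n :
  series (fun n => (-1) ^+ n * z ^+ n.*2.+1 / (n.*2.+1)`!%:R : F) n =
  - (i / 2) * (exp_sum (i * z) n.*2 - exp_sum (- (i * z)) n.*2).
Proof.
rewrite /series /exp_sum /=; elim: n => [|n IHn].
  by rewrite !big_geq // subr0 mulr0.
rewrite doubleS !big_nat_recr //= IHn !(exprS _ n.*2).
rewrite -!mul2n !(exprM (- _)) sqrrN.
rewrite -!(exprM (i * z)) !mul2n exprM_i.
set c := (-1) ^+ n; set p := z ^+ n.*2.
(* Writing [c] as [i ^+ 2 * - c] makes the goal an identity in a free variable [i], as [field]
   needs. *)
rewrite -[c in LHS]opprK -(mulN1r (- c)) -i_sqr; field.
by rewrite !pnatr_eq0 -!lt0n !fact_gt0.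
Qed.

Lemma ccos_euler (z a b : F) :
  exp_sum (i * z) @ \oo --> a -> exp_sum (- (i * z)) @ \oo --> b ->
  ccos z = 2^-1 * (a + b).
Proof.
move=> /cvg_double acvg /cvg_double bcvg.
apply: (cvg_lim (@norm_hausdorff _ F)); rewrite (funext (cos_sumE z)).
by apply: cvgM; [exact: cvg_cst|exact: cvgD].
Qed.

Lemma csin_euler (z a b : F) :
  exp_sum (i * z) @ \oo --> a -> exp_sum (- (i * z)) @ \oo --> b ->
  csin z = - (i / 2) * (a - b).
Proof.
move=> /cvg_double acvg /cvg_double bcvg.
apply: (cvg_lim (@norm_hausdorff _ F)); rewrite (funext (sin_sumE z)).
by apply: cvgM; [exact: cvg_cst|exact: cvgB].
Qed.

(** Here [a], [a'] stand for the exponentials of [i x], [- i x], and [b], [b'] for those of [i y],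
    [- i y]. *)
Lemma euler_cosD (a a' b b' : F) :
  2^-1 * (a * b + a' * b') = 2^-1 * (a + a') * (2^-1 * (b + b')) -
    (- (i / 2) * (a - a')) * (- (i / 2) * (b - b')).
Proof.
have -> : - (i / 2) * (a - a') * (- (i / 2) * (b - b')) =
  i ^+ 2 * ((a - a') * (b - b')) / 4 by field.
by rewrite i_sqr; field.
Qed.

Lemma euler_sinD (a a' b b' : F) :
  - (i / 2) * (a * b - a' * b') =
    - (i / 2) * (a - a') * (2^-1 * (b + b')) +
    2^-1 * (a + a') * (- (i / 2) * (b - b')).
Proof. by field. Qed.
End Euler.

(** * Addition formulas for the complex cosine and sine *)

Lemma ccosE (R : realType) (z : C R) :
  ccos z = 2^-1 * (cexp ('i%C * z) + cexp (- ('i%C * z))).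
Proof. by apply: (ccos_euler (sqr_i R)); exact: cvg_cexp. Qed.

Lemma csinE (R : realType) (z : C R) :
  csin z = - ('i%C / 2) * (cexp ('i%C * z) - cexp (- ('i%C * z))).
Proof. by apply: (csin_euler (sqr_i R)); exact: cvg_cexp. Qed.

Lemma cexp_iD (R : realType) (x y : C R) :
  cexp ('i%C * (x + y)) = cexp ('i%C * x) * cexp ('i%C * y).
Proof. by rewrite mulrDr cexpD. Qed.

Lemma cexp_NiD (R : realType) (x y : C R) :
  cexp (- ('i%C * (x + y))) = cexp (- ('i%C * x)) * cexp (- ('i%C * y)).
Proof. by rewrite mulrDr opprD cexpD. Qed.

Lemma ccosD (R : realType) (x y : C R) :
  ccos (x + y) = ccos x * ccos y - csin x * csin y.
Proof.
by rewrite !ccosE !csinE cexp_iD cexp_NiD; apply: euler_cosD; exact: sqr_i.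
Qed.

Lemma csinD (R : realType) (x y : C R) :
  csin (x + y) = csin x * ccos y + ccos x * csin y.
Proof. by rewrite !ccosE !csinE cexp_iD cexp_NiD; exact: euler_sinD. Qed.

End ExpSeries.

(** * Algebra of rotations *)

Section Rotation.
Local Set Implicit Arguments.
Local Unset Strict Implicit.
Variables (K : comNzRingType) (W : lmodType K).
Implicit Types (A B : {linear W -> W}) (c s : K).

Definition rotation A c s (t : W) : W := c *: t + s *: A t.

(** As [A] squares to -1, the pairs [(c, s)] multiply like the complex numbers [c + s i]. *)
Lemma rotationD A c c' s s' : (forall t, A (A t) = - t) ->
  forall t, rotation A c s (rotation A c' s' t) =
    rotation A (c * c' - s * s') (s * c' + c * s') t.
Proof.
move=> AA t; rewrite /rotation (raddfD A) /= !(linearZ_LR A) AA.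
rewrite !scalerDr !scalerN !scalerA scalerBl scalerDl.
by rewrite [s * c' *: _ - _]addrC addrACA [c * s' *: _ + _]addrC.
Qed.

Lemma rotationC A B c c' s s' : (forall t, A (B t) = B (A t)) ->
  forall t, rotation A c s (rotation B c' s' t) =
    rotation B c' s' (rotation A c s t).
Proof.
move=> AB t; rewrite /rotation (raddfD A) (raddfD B) /=.
rewrite !(linearZ_LR A) !(linearZ_LR B) AB.
rewrite !scalerDr !scalerA addrACA.
by rewrite ![s' * _]mulrC ![c' * _]mulrC.
Qed.

Lemma rotation_braid A B c c' s s' :
  (forall t, A (A t) = - t) -> (forall t, B (B t) = - t) ->
  (forall t, A (B t) = B (A t)) ->
  forall t, let c2 := c * c' - s * s' in let s2 := s * c' + c * s' in
    rotation A c s (rotation B c2 s2 (rotation A c' s' t)) =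
    rotation B c' s' (rotation A c2 s2 (rotation B c s t)).
Proof.
move=> AA BB AB t /=.
(* Both sides become [rotation A c2 s2 (rotation B c2 s2 t)], up to the order of products in the
   coefficients. *)
rewrite (rotationC _ _ _ _ AB) (rotationD _ _ _ _ AA) -(rotationC _ _ _ _ AB).
rewrite -(rotationC _ _ _ _ AB) (rotationD _ _ _ _ BB).
by congr (rotation A _ _ (rotation B _ _ t)); ring.
Qed.
End Rotation.

(** * Transfer of linear relations to the legs of the triple tensor product *)

Section Legs.
Variables (K : comNzRingType) (V : lmodType K).
Variables (S T : {linear V ⊗ V -> V ⊗ V}) (a b : K).

Lemma op12_lin : (forall t, S t = a *: t + b *: T t) ->
  forall t, op12 S t = a *: t + b *: op12 T t.
Proof.
move=> ST; apply: (@tensor_ext _ _ _ _ (op12 S)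
  ((a \*: idfun) \+ (b \*: op12 T))).
by move=> t w /=; rewrite !op12E ST tensDl !tensZl.
Qed.

(** In use [a] is -1; the scalar form makes the right side the linear map [a \*: idfun], which
    [tensor_ext] can compare. *)
Lemma op12_sqr : (forall t, T (T t) = a *: t) ->
  forall t, op12 T (op12 T t) = a *: t.
Proof.
move=> TT; apply: (@tensor_ext _ _ _ _ (op12 T \o op12 T) (a \*: idfun)).
by move=> t w /=; rewrite !op12E TT tensZl.
Qed.

Lemma op23_lin : (forall t, S t = a *: t + b *: T t) ->
  forall t, op23 S t = a *: t + b *: op23 T t.
Proof.
move=> ST; apply: (@tensor_ext3l _ _ _ _ _ (op23 S)
  ((a \*: idfun) \+ (b \*: op23 T))).
move=> u v w /=; rewrite !op23E ST tensDr !tensZr.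
by rewrite linearD !linearZ /= tensor_assoc_invE.
Qed.

(** [op23 T] is the conjugate of [M] by the associator, so the inner associators cancel in its
    square. *)
Lemma op23_sqr : (forall t, T (T t) = a *: t) ->
  forall t, op23 T (op23 T t) = a *: t.
Proof.
move=> TT t; set M := tensor_map (idfun : {linear V -> V}) T.
have M_sqr u : M (M u) = a *: u.
  apply: (@tensor_ext _ _ _ _ (M \o M) (a \*: idfun)) u => v w /=.
  by rewrite !tensor_mapE TT tensZr.
change (tensor_assoc_inv
  (M (tensor_assoc (tensor_assoc_inv (M (tensor_assoc t))))) = a *: t).
rewrite (tensor_assoc_invK (M (tensor_assoc t))) M_sqr.
transitivity (a *: tensor_assoc_inv (tensor_assoc t)); first exact: linearZ.
by rewrite (tensor_assocK t).
Qed.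

End Legs.

Theorem mainTheorem3 (R : realType) (V : lmodType R[i])
    (J : {linear V ⊗ V -> V ⊗ V})
    (J_sqr : forall t : V ⊗ V, J (J t) = - t)
    (J_comm : op12 J \o op23 J =1 op23 J \o op12 J)
    (x y : R[i]) :
  op12 (Rmat J x) \o op23 (Rmat J (x + y)) \o op12 (Rmat J y) =1
  op23 (Rmat J y) \o op12 (Rmat J (x + y)) \o op23 (Rmat J x).
Proof.
have R12 z t : op12 (Rmat J z) t = rotation (op12 J) (ccos z) (csin z) t.
  exact: op12_lin.
have R23 z t : op23 (Rmat J z) t = rotation (op23 J) (ccos z) (csin z) t.
  exact: op23_lin.
have J_sqrZ t : J (J t) = -1 *: t by rewrite J_sqr scaleN1r.
have J12_sqr t : op12 J (op12 J t) = - t.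
  by rewrite (op12_sqr _ _ _ _ J_sqrZ) scaleN1r.
have J23_sqr t : op23 J (op23 J t) = - t.
  by rewrite (op23_sqr _ _ _ _ J_sqrZ) scaleN1r.
move=> t.
(* Chained by [etrans] because [rewrite R12] would try to unify [op12] with [op23]
   terms and unfold the tensor quotients. *)
apply: etrans (_ : rotation (op12 J) (ccos x) (csin x) (rotation (op23 J)
  (ccos (x + y)) (csin (x + y)) (rotation (op12 J) (ccos y) (csin y) t)) = _).
  exact: etrans (R12 _ _) (congr1 _ (etrans (R23 _ _) (congr1 _ (R12 _ _)))).
rewrite ccosD csinD (rotation_braid _ _ _ _ J12_sqr J23_sqr J_comm) -ccosD -csinD.
apply/esym.
exact: etrans (R23 _ _) (congr1 _ (etrans (R12 _ _) (congr1 _ (R23 _ _)))).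
Qed.
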